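(* Let $\mathcal{S}$ be a finite set of states, $\mathcal{A}$ a set of actions, $\gamma\in\mathbb{R}$ the discount factor, $s,s'\in\mathcal{S}$ and $a\in\mathcal{A}$. Let $\hat{\mathcal{R}}_{sa}\in\mathbb{R}$ be the estimated expected reward for taking action $a$ in $s$ and, for $s''\in\mathcal{S}$, let $\hat{\mathcal{P}}_{sa}^{s''}\in\mathbb{R}$ be the estimated probability of transition from $s$ to $s''$ under action $a$. Let $V:\mathcal{S}\to\mathbb{R}$ be the current state-value estimate, $Q(s,a)\in\mathbb{R}$ the current action-value estimate, and $U_{sa}:\mathcal{S}\to\mathbb{R}$ the current function of successor-state values associated with $(s,a)$. Suppose that currently $$Q(s,a)=\hat{\mathcal{R}}_{sa}+\gamma\sum_{s''\in\mathcal{S}}\hat{\mathcal{P}}_{sa}^{s''}\,U_{sa}(s'').\qquad(\ast)$$ Perform, in this order, the assignments $$Q(s,a)\leftarrow Q(s,a)+\gamma\,\hat{\mathcal{P}}_{sa}^{s'}\,\bigl[V(s')-U_{sa}(s')\bigr],$$ $$U_{sa}(s')\leftarrow V(s').$$ Then, after these assignments, relation $(\ast)$ still holds for the new values of $Q(s,a)$ and $U_{sa}$, and the new value of $U_{sa}(s')$ is $V(s')$.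
   Context: The setting is model-based control in reinforcement learning. $Q(s,a)$ is an estimate of the optimal action value (the optimal expected discounted return when taking action $a$ in state $s$), and $V(s)$ is a separately stored state-value estimate. $\hat{\mathcal{R}}_{sa}$ and $\hat{\mathcal{P}}_{sa}^{s''}$ are the current estimates of the expected reward and of the transition probabilities. For each state-action pair $(s,a)$, the function $U_{sa}:\mathcal{S}\to\mathbb{R}$ stores the value estimates of successor states that are associated with $(s,a)$. The notation $x\leftarrow e$ denotes assignment: the expression $e$ is evaluated with the current values of all variables and the result becomes the new value of $x$, while all other variables are unchanged. Assignments are executed sequentially. $V$ is stored separately from $Q$, so it is not changed by these assignments; neither are $\gamma$ and the model estimates. *)

(* Defs.v *)
From mathcomp Require Import all_boot all_order all_algebra.
From mathcomp Require Import boolp reals.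
Set Implicit Arguments.
Unset Strict Implicit.
Unset Printing Implicit Defensive.
Import GRing.Theory.
Local Open Scope ring_scope.

(* [V] is a field of its own: it is not derived from [Q], so it does not
   follow the changes made to [Q]. *)
Record memory (R : realType) (S : finType) (A : Type) : Type := Memory {
  Q : S -> A -> R;
  V : S -> R;
  U : S -> A -> S -> R;
  Rhat : S -> A -> R;
  Phat : S -> A -> S -> R
}.

(* The test is classical, so that the action set [A] can be arbitrary. *)
Definition upd (T W : Type) (f : T -> W) (x : T) (w : W) : T -> W :=
  fun y => if `[< y = x >] then w else f y.

Section Assignments.
Variables (R : realType) (S : finType) (A : Type).
Implicit Types (m : memory R S A) (e : memory R S A -> R).

(* Right-hand sides [e] are evaluated in the memory before the assignment. *)
Definition assign_Q (s : S) (a : A) e m : memory R S A :=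
  Memory (upd (Q m) s (upd (Q m s) a (e m))) (V m) (U m) (Rhat m) (Phat m).

Definition assign_U (s : S) (a : A) (s' : S) e m : memory R S A :=
  Memory (Q m) (V m) (upd (U m) s (upd (U m s) a (upd (U m s a) s' (e m))))
    (Rhat m) (Phat m).

Definition q_relation (gamma : R) (s : S) (a : A) m : Prop :=
  Q m s a = Rhat m s a + gamma * \sum_(s'' : S) Phat m s a s'' * U m s a s''.

End Assignments.

(* Main.v *)
Require Import Defs.
From mathcomp Require Import all_boot all_order all_algebra.
From mathcomp Require Import boolp reals.
Set Implicit Arguments.
Unset Strict Implicit.
Unset Printing Implicit Defensive.
Import GRing.Theory.
Local Open Scope ring_scope.

(** The right-hand side of the relation is affine in the single value of [U] at [s'], with slope
    [gamma * Phat m s a s']. Replacing that value by [V m s'] thus shifts it by exactly the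
    increment given to [Q], which is computed while [U] is still old. [sum_mul_upd] carries this. *)

Lemma upd_same (T W : Type) (f : T -> W) (x : T) (w : W) : upd f x w x = w.
Proof. by rewrite /upd asboolT. Qed.

Lemma upd_neq (T W : Type) (f : T -> W) (x y : T) (w : W) :
  y <> x -> upd f x w y = f y.
Proof. by move=> neq_yx; rewrite /upd asboolF. Qed.

(** Only the term at [x] changes, so the sum moves by [p x] times the change of value. *)
Lemma sum_mul_upd (R : pzRingType) (S : finType) (p u : S -> R) (x : S) (w : R) :
  \sum_y p y * upd u x w y = \sum_y p y * u y + p x * (w - u x).
Proof.
rewrite (bigD1 x) //= [in RHS](bigD1 x) //= upd_same mulrBr.
(* On the right, [p x * u x] cancels, leaving [p x * w] plus the terms off [x]. *)
rewrite addrAC [X in _ = X + _]addrC subrK; congr (_ + _).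
by apply: eq_bigr => y /eqP neq_yx; rewrite upd_neq.
Qed.

Theorem theorem3p3 (R : realType) (S : finType) (A : Type) (gamma : R)
    (s s' : S) (a : A) (m : memory R S A) :
  q_relation gamma s a m ->
  let m' :=
    (assign_Q s a (fun k =>
       Q k s a + gamma * Phat k s a s' * (V k s' - U k s a s'))
     \; assign_U s a s' (fun k => V k s')) m in
  q_relation gamma s a m' /\ U m' s a s' = V m s'.
Proof.
move=> rel_m; rewrite /q_relation /= !upd_same; split=> //.
(* With the increment split off, the rest is the old right-hand side, which [rel_m] folds into
   [Q m s a]. *)
by rewrite sum_mul_upd [in RHS]mulrDr mulrA addrA -rel_m.
Qed.
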